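(* Let $m\ge d$ and let $p\in\mathbb{N}$ be even. There exist points $\bm x^1,\dots,\bm x^N$ in $\mathbb{S}^d$ and positive weights $w_1,\dots,w_N$ with $w_1+\dots+w_N=1$ and $N\le\dim(\Pi_{pm})\le(9pm/d)^d$ such that $$\int_{\mathbb{S}^d}|f(\bm x)|^p\,\mathrm d\mu(\bm x)=\sum_{i=1}^N w_i|f(\bm x^i)|^p\quad\text{for all } f\in\Pi_m .$$
   Context: $d,m\in\mathbb{N}=\{1,2,\dots\}$. $\mathbb{S}^d=\{\bm x\in\mathbb{R}^{d+1}:\|\bm x\|=1\}$ is the $d$-dimensional unit sphere and $\mu$ is its normalized surface measure. For $r\in\mathbb{N}$, $\Pi_r$ is the real vector space of restrictions to $\mathbb{S}^d$ of real polynomials of degree at most $r$ in $d+1$ variables, i.e. the span of the functions $\bm x\mapsto x_1^{k_1}\cdots x_{d+1}^{k_{d+1}}$ on $\mathbb{S}^d$ with $\bm k\in\mathbb{N}_0^{d+1}$, $\|\bm k\|_1\le r$. One has $\dim\Pi_r=\binom{r+d}{d}+\binom{r+d-1}{d}$. *)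

(* Defs.v *)
From HB Require Import structures.
From mathcomp Require Import all_boot all_order all_algebra.
From mathcomp Require Import all_classical all_reals all_analysis.
From mathcomp Require Import measurable_realfun.
Set Implicit Arguments.
Unset Strict Implicit.
Unset Printing Implicit Defensive.
Import Order.TTheory GRing.Theory Num.Theory.
Import numFieldNormedType.Exports.
Local Open Scope classical_set_scope.
Local Open Scope ring_scope.

(** R^n is [n.-tuple R] with the product sigma-algebra; its Lebesgue measure is
    the iterated product measure transported along R * R^n ~ R^(n+1). *)

Section lebesgue_cons.
Context {R : realType} (n : nat).
Local Open Scope ereal_scope.

Definition cons_tup (xt : R * n.-tuple R) : n.+1.-tuple R :=
  [tuple of xt.1 :: xt.2].

Definition uncons_tup (t : n.+1.-tuple R) : R * n.-tuple R :=
  (thead t, [tuple of behead t]).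

Lemma cons_tupK : cancel cons_tup uncons_tup.
Proof. by case=> x t; congr (_, _); apply/val_inj. Qed.

Lemma uncons_tupK : cancel uncons_tup cons_tup.
Proof. by move=> t; rewrite /cons_tup/= -tuple_eta. Qed.

Lemma measurable_cons_tup : measurable_fun [set: R * n.-tuple R] cons_tup.
Proof. exact: measurable_cons. Qed.

Lemma measurable_uncons_tup : measurable_fun [set: n.+1.-tuple R] uncons_tup.
Proof.
apply: measurable_fun_pair; first exact: measurable_tnth.
exact: measurable_behead.
Qed.

Variable m : {sigma_finite_measure set (n.-tuple R) -> \bar R}.

Definition lebesgue_cons : set (n.+1.-tuple R) -> \bar R :=
  pushforward (lebesgue_measure \x m) cons_tup.

Let lebesgue_cons0 : lebesgue_cons set0 = 0.
Proof. by rewrite /lebesgue_cons /pushforward preimage_set0 measure0. Qed.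

Let lebesgue_cons_ge0 A : 0 <= lebesgue_cons A.
Proof. exact: integral_ge0. Qed.

Let lebesgue_cons_sigma_additive : semi_sigma_additive lebesgue_cons.
Proof.
have mc := @measurable_cons_tup.
exact: measure_semi_sigma_additive.
Qed.

HB.instance Definition _ := isMeasure.Build _ _ _ lebesgue_cons
  lebesgue_cons0 lebesgue_cons_ge0 lebesgue_cons_sigma_additive.

Let lebesgue_cons_sigma_finite : sigma_finite setT lebesgue_cons.
Proof.
have /sigma_finiteP[F [TF ndF Foo]] := sigma_finiteT
  (lebesgue_measure : {sigma_finite_measure set (measurableTypeR R) -> \bar R}).
have /sigma_finiteP[G [TG ndG Goo]] := sigma_finiteT m.
exists (fun k => uncons_tup @^-1` (F k `*` G k)).
  apply/esym; rewrite -subTset => t _.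
  have [k _ Fk] : (\bigcup_k F k) (uncons_tup t).1 by rewrite -TF.
  have [l _ Gl] : (\bigcup_k G k) (uncons_tup t).2 by rewrite -TG.
  exists (maxn k l) => //; split.
    by move: Fk; exact/subsetPset/ndF/leq_maxl.
  by move: Gl; exact/subsetPset/ndG/leq_maxr.
move=> k; have [mF Fk] := Foo k; have [mG Gk] := Goo k; split.
  rewrite -[X in measurable X]setTI; apply: measurable_uncons_tup => //.
  exact: measurableX.
rewrite /lebesgue_cons /pushforward -comp_preimage.
rewrite (_ : uncons_tup \o cons_tup = id) ?preimage_id//.
  rewrite product_measure1E//.
  by apply: lte_mul_pinfty => //; rewrite ge0_fin_numE.
by apply/funext => xt /=; rewrite cons_tupK.
Qed.

HB.instance Definition _ := Measure_isSigmaFinite.Build _ _ _ lebesgue_cons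
  lebesgue_cons_sigma_finite.

End lebesgue_cons.

Fixpoint lebesgue_tuple (R : realType) (n : nat) :
    {sigma_finite_measure set (n.-tuple R) -> \bar R} :=
  match n with
  | 0 => dirac [tuple]
  | n'.+1 => lebesgue_cons (lebesgue_tuple R n')
  end.

Section lebesgue_box.
Context {R : realType}.
Local Open Scope ereal_scope.

Definition box n (I : set R) : set (n.-tuple R) :=
  [set t | forall i, I (tnth t i)].
Arguments box : clear implicits.

Lemma measurable_box n (I : set R) : measurable I -> measurable (box n I).
Proof.
move=> mI.
rewrite (_ : box n I = \bigcap_(i in [set: 'I_n]) ((@tnth _ R ^~ i) @^-1` I)).
  apply: fin_bigcap_measurable => [|i _]; first exact: finite_finset.
  by rewrite -[X in measurable X]setTI; exact: measurable_tnth.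
by apply/seteqP; split=> [t It i _|t It i]; exact: It.
Qed.

Lemma lebesgue_tuple_box n (I : set R) : measurable I ->
  lebesgue_tuple R n (box n I) = lebesgue_measure I ^+ n.
Proof.
move=> mI; elim: n => [|n IHn] /=.
  by rewrite diracE mem_set// => -[].
rewrite /lebesgue_cons /pushforward.
rewrite (_ : _ @^-1` _ = I `*` box n I).
  rewrite product_measure1E//=; last exact: measurable_box.
  by rewrite IHn; case: n {IHn} => //; rewrite mule1.
apply/seteqP; split=> [[x t]/= H|[x t]/= [Ix It] i].
  split=> [|i]; first by have := H ord0; rewrite tnth0.
  by have := H (lift ord0 i); rewrite tnthS.
case: (unliftP ord0 i) => [j|] ->; first by rewrite tnthS.
by rewrite tnth0.
Qed.

End lebesgue_box.
Arguments box {R} n I.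

Definition enorm {R : realType} {n : nat} (x : n.-tuple R) : R :=
  Num.sqrt (\sum_i tnth x i ^+ 2).

Definition sphere (R : realType) (d : nat) : Type :=
  {x : d.+1.-tuple R | enorm x == 1}.

Section sphere_structures.
Context {R : realType} {d : nat}.

Let e0 : d.+1.-tuple R := [tuple (i == ord0)%:R | i < d.+1].

Let enorm_e0 : enorm e0 == 1.
Proof.
rewrite /enorm (bigD1 ord0)//= big1 => [|i /negPf i0]; last first.
  by rewrite tnth_mktuple i0 expr0n.
by rewrite tnth_mktuple eqxx expr1n addr0 sqrtr1.
Qed.

HB.instance Definition _ := SubChoice.on (sphere R d).
HB.instance Definition _ := isPointed.Build (sphere R d) (exist _ e0 enorm_e0).
HB.instance Definition _ := Measurable.copy (sphere R d)
  (g_sigma_algebra_preimageType (fun u : sphere R d => sval u)).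

End sphere_structures.

Definition sphere_coord {R : realType} {d : nat} (u : sphere R d)
    (i : 'I_d.+1) : R :=
  tnth (sval u) i.

Section surface_measure.
Context {R : realType} {d : nat}.
Local Open Scope ereal_scope.

(* Up to the null set {0}, the part of the unit ball seen from 0 through A; the
   surface measure of A is d+1 times the volume of this cone. *)
Definition cone (A : set (sphere R d)) : set (d.+1.-tuple R) :=
  [set x | exists r u, [/\ (0 < r <= 1)%R, A u &
                           forall i, tnth x i = (r * sphere_coord u i)%R]].

Definition surface_measure (A : set (sphere R d)) : \bar R :=
  d.+1%:R%:E * lebesgue_tuple R d.+1 (cone A).

Lemma measurable_enorm n : measurable_fun [set: n.-tuple R] (@enorm R n).
Proof.
rewrite (_ : enorm = (@powR R ^~ 2^-1) \o (fun x => \sum_i tnth x i ^+ 2))%R.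
  apply: measurableT_comp; first exact: measurable_powR.
  by apply: measurable_sum => i; apply: measurable_funX; exact: measurable_tnth.
apply/funext => x; rewrite /= powR12_sqrt//.
by apply: sumr_ge0 => i _; exact: sqr_ge0.
Qed.

Let normalized (x : d.+1.-tuple R) : d.+1.-tuple R :=
  [tuple (tnth x i * (enorm x)^-1)%R | i < d.+1].

Let radial (x : d.+1.-tuple R) : sphere R d :=
  insubd (point : sphere R d) (normalized x).

Let measurable_normalized : measurable_fun setT normalized.
Proof.
apply/measurable_fun_tnthP => i.
rewrite (_ : _ \o _ =
    (fun x => tnth x i) \* ((@powR R ^~ (-1)) \o (@enorm R d.+1)))%R.
  apply: measurable_funM; first exact: measurable_tnth.
  by apply: measurableT_comp; [exact: measurable_powR|exact: measurable_enorm].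
by apply/funext => x /=; rewrite tnth_mktuple powR_inv1// sqrtr_ge0.
Qed.

Let measurable_radial : measurable_fun setT radial.
Proof.
move=> _ _ [B mB <-]; rewrite !setTI -comp_preimage -[X in measurable X]setTI.
have -> : sval \o radial =
    fun x => if enorm (normalized x) == 1%R then normalized x
    else sval (point : sphere R d).
  by apply/funext => x; rewrite /= /radial val_insubd.
apply: measurable_fun_ifT => //.
apply: measurable_fun_eqr => //; apply: measurableT_comp => //.
exact: measurable_enorm.
Qed.

Let ball : set (d.+1.-tuple R) := [set x | (0 < enorm x <= 1)%R].

Let measurable_ball : measurable ball.
Proof.
rewrite (_ : ball = setT `&` enorm @^-1` `]0%R, 1%R]).
  by apply: measurable_enorm => //; exact: measurable_itv.
by rewrite setTI; apply/seteqP; split => x /=; rewrite /ball/= in_itv.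
Qed.

Let enormZ (x y : d.+1.-tuple R) (r : R) : (0 <= r)%R ->
  (forall i, tnth x i = r * tnth y i)%R -> enorm x = (r * enorm y)%R.
Proof.
move=> r0 xE; rewrite /enorm -[X in (X * _)%R](ger0_norm r0) -sqrtr_sqr.
rewrite -sqrtrM ?sqr_ge0// mulr_sumr; congr Num.sqrt.
by apply: eq_bigr => i _; rewrite xE exprMn.
Qed.

Let coneE A : cone A = ball `&` radial @^-1` A.
Proof.
apply/seteqP; split=> [x [r [u [/andP[r0 r1] Au xE]]]|x [/andP[x0 x1] Ax]].
  have nx : enorm x = r.
    by rewrite (enormZ (ltW r0) xE) (eqP (svalP u)) mulr1.
  split; first by rewrite /ball/= nx r0.
  rewrite /= (_ : radial x = u)//; apply/val_inj; rewrite val_insubd.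
  have -> : normalized x = sval u.
    apply/eq_from_tnth => i.
    by rewrite tnth_mktuple nx xE mulrAC divff ?mul1r// gt_eqF.
  by rewrite (svalP u).
exists (enorm x), (radial x); split => // [|i]; first by rewrite x0.
rewrite /sphere_coord (_ : sval _ = normalized x).
  by rewrite tnth_mktuple mulrCA divff ?mulr1// gt_eqF.
apply: insubdK; rewrite -topredE/= (@enormZ _ x (enorm x)^-1%R).
- by rewrite mulVf// gt_eqF.
- by rewrite invr_ge0 ltW.
- by move=> j; rewrite tnth_mktuple mulrC.
Qed.

Lemma measurable_cone A : measurable A -> measurable (cone A).
Proof.
move=> mA; rewrite coneE; apply: measurableI => //.
by rewrite -[X in measurable X]setTI; exact: measurable_radial.
Qed.

Let surface_measure0 : surface_measure set0 = 0.
Proof.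
by rewrite /surface_measure coneE preimage_set0 setI0 measure0 mule0.
Qed.

Let surface_measure_ge0 A : 0 <= surface_measure A.
Proof. by apply: mule_ge0 => //; rewrite lee_fin. Qed.

Let surface_measure_sigma_additive : semi_sigma_additive surface_measure.
Proof.
move=> F mF tF mUF; rewrite /surface_measure.
have coneU : cone (\bigcup_n F n) = \bigcup_n cone (F n).
  apply/seteqP; split=> [x [r [u [r01 [n _ Fu] xE]]]|x [n _ [r [u [r01 Fu xE]]]]].
    by exists n => //; exists r, u.
  by exists r, u; split => //; exists n.
rewrite coneU.
under eq_fun do rewrite -ge0_sume_distrr//.
apply: cvgeZl => //; apply: measure_semi_sigma_additive.
- by move=> n; exact: measurable_cone.
- move/trivIsetP : tF => tF; apply/trivIsetP => i j _ _ ij.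
  by rewrite !coneE setIACA -(preimage_setI radial) tF// preimage_set0 setI0.
- by rewrite -coneU; exact: measurable_cone.
Qed.

HB.instance Definition _ := isMeasure.Build _ _ _ surface_measure
  surface_measure0 surface_measure_ge0 surface_measure_sigma_additive.

Let coneT : cone setT = ball.
Proof. by rewrite coneE preimage_setT setIT. Qed.

Lemma surface_measureT_gt0 : 0 < surface_measure setT.
Proof.
rewrite /surface_measure; apply: mule_gt0; first by rewrite lte_fin.
rewrite coneT.
pose I : set R := `]0%R, d.+1%:R^-1%R]%classic.
have mI : measurable I by exact: measurable_itv.
apply: (@lt_le_trans _ _ (lebesgue_tuple R d.+1 (box d.+1 I))).
  rewrite lebesgue_tuple_box// expe_gt0// lebesgue_measure_itv/= lte_fin.
  by rewrite invr_gt0 ltr0n sube0 lte_fin invr_gt0 ltr0n.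
apply: le_measure; rewrite ?inE//; first exact: measurable_box.
move=> x Ix; have x_gt0 i : (0 < tnth x i)%R.
  by have := Ix i; rewrite /I/= in_itv => /andP[].
have x_le i : (tnth x i <= d.+1%:R^-1)%R.
  by have := Ix i; rewrite /I/= in_itv => /andP[].
rewrite /ball/= /enorm sqrtr_gt0; apply/andP; split.
  rewrite (bigD1 ord0)//= ltr_pwDl ?exprn_gt0//.
  by apply: sumr_ge0 => i _; exact: sqr_ge0.
rewrite -[leRHS]sqrtr1 ler_wsqrtr//.
apply: (@le_trans _ _ (\sum_(i < d.+1) d.+1%:R^-1)%R).
  apply: ler_sum => i _; rewrite expr2.
  rewrite -[leRHS]mul1r; apply: ler_pM => //; [exact: ltW|exact: ltW|].
  by rewrite (le_trans (x_le i))// invf_le1// ler1n.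
by rewrite sumr_const card_ord -[leLHS]mulr_natl divff.
Qed.

Lemma surface_measureT_lty : surface_measure setT < +oo.
Proof.
rewrite /surface_measure coneT lte_mul_pinfty ?lee_fin//.
pose I : set R := `[(-1)%R, 1%R]%classic.
have mI : measurable I by exact: measurable_itv.
apply: (@le_lt_trans _ _ (lebesgue_tuple R d.+1 (box d.+1 I))).
  apply: le_measure; rewrite ?inE//; first exact: measurable_box.
  move=> x /andP[_ x1] i; rewrite /I/= in_itv/= -ler_norml -sqrtr_sqr.
  apply: le_trans x1; rewrite ler_wsqrtr// (bigD1 i)//= lerDl.
  by apply: sumr_ge0 => j _; exact: sqr_ge0.
rewrite lebesgue_tuple_box// lebesgue_measure_itv/=; case: ifP => _.
  by rewrite -EFinB -EFin_expe; case: (d) => [|n]; rewrite -?EFinM ltry.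
by case: (d) => [|n]; rewrite ?mul0e ltry.
Qed.

(* The default argument of [mnormalize] is irrelevant by the two lemmas above;
   see [sphere_measureE]. *)
Definition sphere_measure : probability (sphere R d) R :=
  mnormalize surface_measure (dirac point).

Lemma sphere_measureE A : sphere_measure A =
  surface_measure A * (fine (surface_measure setT))^-1%:E.
Proof.
rewrite /sphere_measure/= /mnormalize.
by rewrite (gt_eqF surface_measureT_gt0) (lt_eqF surface_measureT_lty).
Qed.

End surface_measure.

Section lin_dimension.
Context {K : fieldType} {V : lmodType K}.
Implicit Types E : set V.

Definition basis_of_size E (n : nat) (b : 'I_n -> V) : Prop :=
  (forall c : 'I_n -> K, \sum_i c i *: b i = 0 -> forall i, c i = 0) /\
  E = [set v | exists c : 'I_n -> K, v = \sum_i c i *: b i].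

Definition has_dim E (n : nat) : Prop :=
  exists b : 'I_n -> V, basis_of_size E b.

(* [dimension E] is 0 when [E] has no finite basis; otherwise it is the size of
   any basis, by [has_dimE]. *)
Definition dimension E : nat := xget 0%N [set n | has_dim E n].

Lemma has_dim_le E n n' (b : 'I_n -> V) (b' : 'I_n' -> V) :
  basis_of_size E b -> basis_of_size E b' -> (n <= n')%N.
Proof.
move=> [bfree Eb] [_ Eb'].
have bE i : exists c : 'I_n' -> K, b i = \sum_j c j *: b' j.
  have : E (b i).
    rewrite Eb; exists (fun j => (j == i)%:R).
    rewrite (bigD1 i)//= eqxx scale1r big1 ?addr0// => j /negPf ->.
    by rewrite scale0r.
  by rewrite Eb'.
have /choice[C CE] := bE.
pose M := \matrix_(i < n, j < n') C i j.
suff /eqP <- : row_free M by exact: rank_leq_col.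
apply/row_freeP/row_freeP; rewrite -kermx_eq0; apply/eqP/row_matrixP => k.
rewrite row0; apply/rowP => i; rewrite [RHS]mxE.
set u := row k _; have uM : u *m M = 0.
  by apply/sub_kermxP; exact: row_sub.
apply: (bfree (u 0)); under eq_bigr do rewrite CE scaler_sumr.
rewrite exchange_big/= big1// => j _.
under eq_bigr do rewrite scalerA; rewrite -scaler_suml.
have := congr1 (fun A : 'rV_n' => A 0 j) uM; rewrite !mxE.
by under eq_bigr do rewrite [M _ _]mxE; move=> ->; rewrite scale0r.
Qed.

Lemma has_dimE E n : has_dim E n -> dimension E = n.
Proof.
move=> En; apply: xget_unique => // m [b bE]; have [b' b'E] := En.
by apply/eqP; rewrite eqn_leq (has_dim_le bE b'E) (has_dim_le b'E bE).
Qed.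

End lin_dimension.

Definition monomial {R : realType} {d r : nat} (k : {ffun 'I_d.+1 -> 'I_r.+1})
    (u : sphere R d) : R :=
  \prod_i sphere_coord u i ^+ k i.

(* Exponents bounded by r entrywise, which is no restriction when their sum is
   at most r, so that the sum below is finite. *)
Definition Pi (R : realType) (d r : nat) : set (sphere R d -> R^o) :=
  [set f | exists c : {ffun 'I_d.+1 -> 'I_r.+1} -> R, forall u,
    f u = \sum_(k : {ffun 'I_d.+1 -> 'I_r.+1} | (\sum_i k i <= r)%N)
            c k * monomial k u].
Arguments Pi R d r : clear implicits.

(* Main.v *)
Require Import Defs.
From mathcomp Require Import all_boot all_order all_algebra.
From mathcomp Require Import all_classical all_reals all_analysis.
From mathcomp Require Import measurable_realfun zify.
Set Implicit Arguments.
Unset Strict Implicit.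
Unset Printing Implicit Defensive.
Import Order.TTheory GRing.Theory Num.Theory.
Local Open Scope classical_set_scope.
Local Open Scope ring_scope.

(** For even [p] and [f] in [Pi m], [|f| ^ p = f ^ p] lies in [Pi (p * m)], so it
    suffices to find a positive quadrature rule with at most [n = dim (Pi (p * m))]
    nodes that is exact on [Pi (p * m)]; its weights sum to 1 because constants are
    integrated exactly. The integrals of a basis form a vector of [R^n], which lies
    in the convex cone generated by the point evaluations: otherwise a separating
    functional yields a nontrivial combination of the basis functions that is
    nonnegative and has integral at most 0, hence vanishes almost everywhere; one
    basis function is then redundant on a set of full measure, and one
    concludes by induction on [n]. No compactness is needed. Caratheodory's theorem
    for cones reduces the number of nodes to [n].
    Eliminating even powers of [x_0] gives [dim (Pi r) <= 2 * 'C(d + r, d)]. *)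

(** * Convex cones with an order unit and their extension by lines *)

Section convex_cones.
Context {R : realType} {V : lmodType R}.
Implicit Types (C G : set V) (c u v : V).

Definition convex_cone C : Prop :=
  [/\ C 0, forall u v, C u -> C v -> C (u + v)
         & forall (a : R) u, 0 <= a -> C u -> C (a *: u)].

Definition conic_hull G : set V :=
  [set v | exists N (w : 'I_N -> R) (g : 'I_N -> V),
     [/\ forall i, 0 <= w i, forall i, G (g i) & v = \sum_i w i *: g i]].

Lemma conic_hull_convex_cone G : convex_cone (conic_hull G).
Proof.
split=> [|u v [N [w [g [w0 Gg ->]]]] [M [z [h [z0 Gh ->]]]]
         |a u a0 [N [w [g [w0 Gg ->]]]]].
- exists 0%N, (fun=> 0), (fun=> 0).
  by split=> [[]|[]|] //; rewrite big_ord0.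
- exists (N + M)%N,
    (fun i => match fintype.split i with inl j => w j | inr j => z j end),
    (fun i => match fintype.split i with inl j => g j | inr j => h j end).
  split=> [i|i|]; [by case: fintype.split|by case: fintype.split|].
  rewrite big_split_ord/=; congr (_ + _); apply: eq_bigr => i _.
    by rewrite -[lshift _ _]/(unsplit (inl i)) unsplitK.
  by rewrite -[rshift _ _]/(unsplit (inr i)) unsplitK.
- exists N, (fun i => a * w i), g.
  split=> // [i|]; first exact: mulr_ge0.
  by rewrite scaler_sumr; apply: eq_bigr => i _; rewrite scalerA.
Qed.

Lemma sub_conic_hull G : G `<=` conic_hull G.
Proof.
move=> g Gg; exists 1%N, (fun=> 1), (fun=> g).
by split=> //; rewrite big_ord1 scale1r.
Qed.

(* A convex cone with order unit [c] can be enlarged by the line through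
   [u - s c], where [s] is the supremum of the [t] with [u - t c] in the cone. *)
Lemma convex_cone_add_line C c u : convex_cone C ->
    (forall v, exists t : R, C (t *: c + v)) -> ~ C (- c) ->
  exists C' (s : R), [/\ convex_cone C', C `<=` C', ~ C' (- c),
    C' (u - s *: c) & C' (s *: c - u)].
Proof.
move=> [C0 CD CZ] Cunit Cc.
pose S := [set t : R | C (u - t *: c)].
have S_ub t : C (t *: c - u) -> ubound S t.
  (* If [t < x], adding [t *: c - u] and [u - x *: c] gives [(t - x) *: c], a positive multiple of
     [- c]. *)
  move=> Ct x Sx; rewrite leNgt; apply/negP => tx; apply: Cc.
  have /(CZ (x - t)^-1) := CD _ _ Ct Sx.
  rewrite addrA subrK -scalerBl scalerA -(opprB x t) mulrN mulVf ?scaleN1r.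
    by apply; rewrite invr_ge0 subr_ge0 ltW.
  by rewrite subr_eq0 gt_eqF.
have S_sup : has_sup S.
  split.
    by have [t Ct] := Cunit u; exists (- t); rewrite /S/= scaleNr opprK addrC.
  by have [t Ct] := Cunit (- u); exists t; exact: S_ub.
set s := sup S.
exists [set v | exists x (y : R), C x /\ v = x + y *: (u - s *: c)], s.
split.
- split=> [|_ _ [x [y [Cx ->]]] [x' [y' [Cx' ->]]]|a _ a0 [x [y [Cx ->]]]].
  + by exists 0, 0; rewrite scale0r addr0.
  + exists (x + x'), (y + y'); split; first exact: CD.
    by rewrite addrACA -scalerDl.
  + exists (a *: x), (a * y); split; first exact: CZ.
    by rewrite scalerDr scalerA.
- by move=> x Cx; exists x, 0; rewrite scale0r addr0.
- move=> [x [y [Cx cE]]].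
  have xE : x = - c - y *: (u - s *: c) by rewrite cE addrK.
  (* Dividing [x] by [|y|] shows that [s - y^-1] belongs to [S] if [y < 0], and is an upper bound of
     [S] if [y > 0]. Either contradicts the choice of [s] as supremum. *)
  have [y0|y0|y0] := ltgtP y 0.
  + have : s - y^-1 <= s.
      apply: ub_le_sup; first by case: S_sup.
      suff : u - (s - y^-1) *: c = (- y)^-1 *: x.
        by rewrite /S/= => ->; apply: CZ; rewrite // invr_ge0 oppr_ge0 ltW.
      rewrite xE scalerBr scalerA invrN mulNr mulVf ?lt_eqF// scaleN1r.
      by rewrite scaleNr scalerN opprK opprK scalerBl opprB addrCA addrC.
    by rewrite gerBl invr_ge0 leNgt y0.
  + have : s <= s - y^-1.
      apply: ge_sup; [by case: S_sup|apply: S_ub].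
      suff -> : (s - y^-1) *: c - u = y^-1 *: x.
        by apply: CZ; rewrite // invr_ge0 ltW.
      rewrite xE scalerBr scalerA mulVf ?gt_eqF// scale1r scalerBl opprB.
      by rewrite scalerN addrCA addrA.
    by rewrite -subr_ge0 addrAC subrr add0r oppr_ge0 invr_le0 leNgt y0.
  + by apply: Cc; rewrite cE y0 scale0r addr0.
- by exists 0, 1; rewrite add0r scale1r.
- by exists 0, (-1); rewrite add0r scaleN1r opprB.
Qed.

(** Adds one line at a time: [c] remains an order unit of every larger cone, and lines already
    present survive each enlargement. *)
Lemma convex_cone_add_lines C c (e : seq V) : convex_cone C ->
    (forall v, exists t : R, C (t *: c + v)) -> ~ C (- c) ->
  exists C', [/\ convex_cone C', C `<=` C', ~ C' (- c) &
    {in e, forall u, exists s : R, C' (u - s *: c) /\ C' (s *: c - u)}].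
Proof.
move=> Ccone Cunit Cc; elim: e => [|u e [C1 [C1cone CC1 C1c C1e]]].
  by exists C; split.
have C1unit v : exists t : R, C1 (t *: c + v).
  by have [t Ct] := Cunit v; exists t; exact: CC1.
have [C2 [s [C2cone C12 C2c Cs Cs']]] := convex_cone_add_line u C1cone C1unit C1c.
exists C2; split => //; first exact: subset_trans C12.
move=> x; rewrite inE => /predU1P[->|/C1e[t [? ?]]]; first by exists s.
by exists t; split; exact: C12.
Qed.

End convex_cones.

(** * Separation from a conic hull in [R^n], and Caratheodory's theorem for cones *)

Section separation.
Context {R : realType} {n : nat}.
Implicit Types (C G : set 'rV[R]_n) (c u v : 'rV[R]_n).

Lemma convex_cone_sum C (I : Type) (s : seq I) (P : pred I) (F : I -> 'rV[R]_n) :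
  convex_cone C -> (forall i, P i -> C (F i)) -> C (\sum_(i <- s | P i) F i).
Proof. by move=> [C0 CD _]; exact: big_ind. Qed.

(* Once a cone contains the lines through [e_i - s_i c], it contains
   [x - l x c] and its opposite for all [x], where [l x = \sum_i x_i s_i]. *)
Lemma order_unit_functional C c : convex_cone C ->
    (forall v, exists t : R, C (t *: c + v)) -> ~ C (- c) ->
  exists s : 'I_n -> R, \sum_i c 0 i * s i = 1 /\
    forall v, C v -> 0 <= \sum_i v 0 i * s i.
Proof.
move=> Ccone Cunit Cc.
have [C' [C'cone CC' C'c /= Ce]] :=
  convex_cone_add_lines [seq delta_mx 0 i | i <- enum 'I_n] Ccone Cunit Cc.
have /choice[s sE] : forall i : 'I_n, exists s : R,
    C' (delta_mx 0 i - s *: c) /\ C' (s *: c - delta_mx 0 i).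
  by move=> i; apply: Ce; apply: map_f; rewrite mem_enum.
exists s; set l := fun v : 'rV_n => \sum_i v 0 i * s i.
have [C'0 C'D C'Z] := C'cone.
have lE v : v - l v *: c = \sum_i v 0 i *: (delta_mx 0 i - s i *: c).
  rewrite {1}(row_sum_delta v) /l scaler_suml -sumrB.
  by apply: eq_bigr => i _; rewrite scalerBr scalerA.
have C'l v : C' (v - l v *: c).
  rewrite lE; apply: convex_cone_sum => // i _.
  have [v0|v0] := leP 0 (v 0 i); first by apply: C'Z => //; case: (sE i).
  rewrite -[_ *: _]opprK -scaleNr -scalerN opprB; apply: C'Z.
    by rewrite oppr_ge0 ltW.
  by case: (sE i).
have C'Nl v : C' (l v *: c - v).
  have lN : l (- v) = - l v.
    by rewrite /l -sumrN; apply: eq_bigr => i _; rewrite mxE mulNr.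
  by have := C'l (- v); rewrite lN scaleNr opprK addrC.
(* Applied to [a = 1 - l c] and [a = l c - 1] this gives [l c = 1]; applied to [a = l v] it gives
   positivity on [C]. *)
have C'a (a : R) : C' (a *: c) -> 0 <= a.
  move=> Ca; rewrite leNgt; apply/negP => a0; apply: C'c.
  have /(C'Z (- a)^-1) := Ca; rewrite scalerA invrN mulNr mulVf ?lt_eqF//.
  by rewrite scaleN1r; apply; rewrite -invrN invr_ge0 oppr_ge0 ltW.
split.
  apply/eqP; rewrite eq_le; apply/andP; split; rewrite -subr_ge0; apply: C'a.
    by rewrite scalerBl scale1r; exact: C'l.
  by rewrite scalerBl scale1r; exact: C'Nl.
move=> v Cv; apply: C'a; rewrite -[_ *: _](subrK v).
by apply: C'D; [exact: C'Nl|exact: CC'].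
Qed.

(** Let the rows of [M] be finitely many elements of [G], of maximal rank. By maximality [G] lies in
    the row space of [M], so when this space is proper, a nonzero column killed by [M] is killed by
    all of [G]. *)
Lemma vanishing_or_spanning G :
  (exists s : 'cV[R]_n, s != 0 /\ forall g, G g -> g *m s = 0) \/
  (exists q (M : 'M[R]_(q, n)), (forall i, G (row i M)) /\ row_full M).
Proof.
pose P k := `[< exists q (M : 'M[R]_(q, n)),
  (forall i, G (row i M)) /\ \rank M = k >].
have P0 : exists k, P k.
  exists 0%N; apply/asboolP; exists 0%N, 0; split=> [[]//|].
  by rewrite mxrank0.
have Pn k : P k -> (k <= n)%N.
  by move=> /asboolP[q [M [_ <-]]]; exact: rank_leq_col.
case: (ex_maxnP P0 Pn) => k /asboolP[q [M [GM Mk]]] kmax.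
have [Mfull|Mnfull] := boolP (row_full M); first by right; exists q, M.
left.
have GsubM g : G g -> (g <= M)%MS.
  move=> Gg; apply/negPn/negP => gM.
  have : P (\rank (col_mx M g)).
    apply/asboolP; exists (q + 1)%N, (col_mx M g); split=> // i.
    rewrite -[i]splitK; case: fintype.split => j /=; rewrite ?rowKu ?rowKd//.
    by rewrite ord1 row_id.
  move=> /kmax; rewrite -Mk leqNgt => /negP; apply; apply: rank_ltmx.
  by rewrite ltmxE col_mx_sub submx_refl/= gM andbT -addsmxE addsmxSl.
have /rowV0Pn[v /sub_kermxP vM v0] : kermx M^T != 0.
  by rewrite kermx_eq0 /row_free mxrank_tr.
exists v^T; split=> [|g /GsubM/submxP[D ->]]; first by rewrite trmx_eq0.
by rewrite -mulmxA -[M]trmxK -trmx_mul vM trmx0 mulmx0.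
Qed.

(** If [G] does not span, a functional vanishing on [G] works up to sign. If it does, the sum [c] of
    a spanning family is an order unit of the hull, and [order_unit_functional] applies to the hull
    enlarged by the ray through [- v]. *)
Lemma conic_hull_separation G v : ~ conic_hull G v ->
  exists s : 'I_n -> R, [/\ exists i, s i != 0,
    forall g, G g -> 0 <= \sum_i g 0 i * s i & \sum_i v 0 i * s i <= 0].
Proof.
have sE (g : 'rV[R]_n) (s : 'cV_n) : (g *m s) 0 0 = \sum_i g 0 i * s i 0.
  by rewrite mxE.
move=> Gv; have [[s [s0 Gs]]|[q [M [GM Mfull]]]] := vanishing_or_spanning G.
  have [i si] : exists i, s i 0 != 0.
    apply: contrapT => /forallNP s_eq0; move/eqP: s0; apply.
    apply/colP => i; rewrite [RHS]mxE; exact/eqP/negPn/negP/s_eq0.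
  have [vs|vs] := leP ((v *m s) 0 0) 0.
    exists (fun i => s i 0); split; first by exists i.
      by move=> g /Gs; rewrite -sE => ->; rewrite mxE.
    by rewrite -sE.
  exists (fun i => - s i 0); split; first by exists i; rewrite oppr_eq0.
    move=> g /Gs gs; under eq_bigr do rewrite mulrN.
    by rewrite sumrN -sE gs mxE oppr0.
  under eq_bigr do rewrite mulrN.
  by rewrite sumrN -sE oppr_le0 ltW.
have [C0 CD CZ] := conic_hull_convex_cone G.
pose C := [set u | exists x (t : R),
  [/\ conic_hull G x, 0 <= t & u = x - t *: v]].
have Ccone : convex_cone C.
  split=> [|_ _ [x [t [Cx t0 ->]]] [x' [t' [Cx' t0' ->]]]
           |a _ a0 [x [t [Cx t0 ->]]]].
  - by exists 0, 0; rewrite scale0r subr0.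
  - exists (x + x'), (t + t'); split; [exact: CD|exact: addr_ge0|].
    by rewrite scalerDl opprD addrACA.
  - exists (a *: x), (a * t); split; [exact: CZ|exact: mulr_ge0|].
    by rewrite scalerBr scalerA.
have hullC : conic_hull G `<=` C.
  by move=> x Gx; exists x, 0; rewrite scale0r subr0.
pose c := \sum_i row i M.
have hullunit u : exists t : R, 0 <= t /\ conic_hull G (t *: c + u).
  have /submxP[D ->] : (u <= M)%MS by exact: submx_full.
  (* This [t] dominates every [- D 0 i], so each row of [M] gets a nonnegative coefficient
     [t + D 0 i]. *)
  exists (\sum_i `|D 0 i|); split; first exact: sumr_ge0.
  rewrite mulmx_sum_row scaler_sumr -big_split/=.
  apply: convex_cone_sum => [|i _]; first exact: conic_hull_convex_cone.
  rewrite -scalerDl; apply: CZ; last exact: sub_conic_hull.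
  rewrite -lerBlDr sub0r (le_trans (ler_norm _))// normrN (bigD1 i)//= lerDl.
  exact: sumr_ge0.
(* From [c = a *: v - x] it follows that [(1 + t * a) *: v] is the sum of [t *: c + v] and [t *: x],
   both in the hull for a suitable [t]; then [v] is in the hull too. *)
have Cc : ~ C (- c).
  move=> [x [a [Gx a0 cE]]]; apply: Gv.
  have [t [t0 tv]] := hullunit v.
  have ta : 0 < 1 + t * a by rewrite ltr_pwDl// mulr_ge0.
  suff -> : v = (1 + t * a)^-1 *: (t *: c + v + t *: x).
    by apply: (CZ); [rewrite invr_ge0 ltW|apply: CD; [|exact: CZ]].
  have -> : t *: c + v + t *: x = (1 + t * a) *: v.
    have -> : c = a *: v - x by rewrite -[c]opprK cE opprB.
    by rewrite scalerBr addrAC subrK scalerDl scale1r scalerA addrC.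
  by rewrite scalerA mulVf ?scale1r// gt_eqF.
have Cunit u : exists t : R, C (t *: c + u).
  by have [t [_ ?]] := hullunit u; exists t; exact: hullC.
have [s [sc sC]] := order_unit_functional Ccone Cunit Cc.
exists s; split.
- apply: contrapT => /forallNP s_eq0; move: sc; rewrite big1 => [/eqP|i _].
    by rewrite eq_sym oner_eq0.
  by have /negP := s_eq0 i; rewrite negbK => /eqP ->; rewrite mulr0.
- by move=> g Gg; apply/sC/hullC/sub_conic_hull.
- have := sC (- v); under eq_bigr do rewrite mxE mulNr.
  rewrite sumrN oppr_ge0; apply.
  by exists 0, 1; rewrite scale1r sub0r.
Qed.
End separation.

(** A representation with the fewest generators has no zero weight. With more than [n] generators,
    subtracting a suitable multiple of a linear relation among them would make a weight vanish while
    all stay nonnegative. *)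
Lemma conic_caratheodory (R : realType) n (G : set 'rV[R]_n) v :
  conic_hull G v -> exists N (w : 'I_N -> R) (g : 'I_N -> 'rV[R]_n),
    [/\ (N <= n)%N, forall i, 0 < w i, forall i, G (g i) &
        v = \sum_i w i *: g i].
Proof.
move=> Gv.
pose P N := `[< exists (w : 'I_N -> R) (g : 'I_N -> 'rV[R]_n),
  [/\ forall i, 0 <= w i, forall i, G (g i) & v = \sum_i w i *: g i] >].
have exP : exists N, P N.
  by have [N [w [g ?]]] := Gv; exists N; apply/asboolP; exists w, g.
case: (ex_minnP exP) => -[|N] /asboolP[w [g [w0 Gg vE]]] Nmin.
  by exists 0%N, w, g; split=> // -[].
have w_neq0 (z : 'I_N.+1 -> R) i : (forall i, 0 <= z i) ->
    v = \sum_i z i *: g i -> z i != 0.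
  move=> z0 vzE; apply/negP => /eqP zi0; suff /Nmin : P N by rewrite ltnn.
  apply/asboolP; exists (z \o lift i), (g \o lift i); split=> [j|j|] /=.
  - exact: z0.
  - exact: Gg.
  - by rewrite vzE (bigD1_ord i)//= zi0 scale0r add0r.
exists N.+1, w, g; split=> [|i||] //; last by rewrite lt0r w0 w_neq0.
rewrite leqNgt; apply/negP => nN.
pose M := \matrix_i g i.
have /rowV0Pn[u /sub_kermxP uM u0] : kermx M != 0.
  by rewrite kermx_eq0 /row_free ltn_eqF// (leq_ltn_trans (rank_leq_col _)).
have {}uM : \sum_i u 0 i *: g i = 0.
  rewrite -[RHS]uM mulmx_sum_row; apply: eq_bigr => i _.
  by rewrite rowK.
(* Replacing [u] by [- u] if necessary, some coefficient of the relation is positive. *)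
wlog [i0 ui0] : u u0 uM / exists i, 0 < u 0 i => [hwlog|].
  have [i ui] : exists i, u 0 i != 0.
    apply: contrapT => /forallNP u_eq0; move/eqP: u0; apply.
    by apply/rowP => i; rewrite [RHS]mxE; exact/eqP/negPn/negP/u_eq0.
  have [ui0|ui0] := ltP 0 (u 0 i); first by apply: (hwlog u) => //; exists i.
  apply: (hwlog (- u)); rewrite ?oppr_eq0//.
    under eq_bigr do rewrite mxE scaleNr.
    by rewrite sumrN uM oppr0.
  by exists i; rewrite mxE oppr_gt0 lt_neqAle ui.
(* The smallest ratio is the largest [t] for which all [w i - t * u 0 i] stay nonnegative; the one
   at [i1] is then zero. *)
pose i1 := [arg min_(i < i0 | 0 < u 0 i) (w i / u 0 i)]%O.
have [ui1 i1min] : 0 < u 0 i1 /\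
    forall i, 0 < u 0 i -> w i1 / u 0 i1 <= w i / u 0 i.
  by rewrite /i1; case: arg_minP.
set t := w i1 / u 0 i1 in i1min.
suff : w i1 - t * u 0 i1 != 0 by rewrite /t divfK ?subrr ?eqxx// gt_eqF.
apply: (w_neq0 (fun i => w i - t * u 0 i)).
- move=> i; rewrite subr_ge0.
  have [ui|ui] := ltP 0 (u 0 i); first by rewrite -ler_pdivlMr// i1min.
  by apply: le_trans (w0 i); rewrite mulr_ge0_le0// divr_ge0// ltW.
- under eq_bigr do rewrite scalerBl -scalerA.
  by rewrite sumrB -vE -scaler_sumr uM scaler0 subr0.
Qed.

(** * Moment vectors of integrable functions *)

Section moments.
Context {d : measure_display} {T : measurableType d} {R : realType}.
Variable P : probability T R.

Lemma integral_lincomb n (phi : 'I_n -> T -> R) (s : 'I_n -> R) :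
  (forall i, P.-integrable setT (EFin \o phi i)) ->
  P.-integrable setT (EFin \o (fun x => \sum_i phi i x * s i)) /\
  (\int[P]_x (\sum_i phi i x * s i)%:E =
    (\sum_i fine (\int[P]_x (phi i x)%:E) * s i)%:E)%E.
Proof.
move=> iphi.
have iphis i : P.-integrable setT (fun x => (s i)%:E * (phi i x)%:E)%E.
  exact: (integrableZl measurableT (s i) (iphi i)).
have E x : (\sum_i phi i x * s i)%:E = (\sum_i (s i)%:E * (phi i x)%:E)%E.
  by rewrite -sumEFin; apply: eq_bigr => i _; rewrite mulrC EFinM.
split.
  have := integrable_sum measurableT (index_enum 'I_n) (fun i (_ : true) => iphis i).
  by apply: eq_integrable => // x _ /=; rewrite E.
under eq_integral do rewrite E.
rewrite integral_sum// -sumEFin; apply: eq_bigr => i _.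
rewrite (integralZl measurableT (iphi i)) mulrC EFinM fineK//.
exact: (integrable_fin_num measurableT (iphi i)).
Qed.

(* If the moment vector is not in the cone, a separating functional gives a
   combination of the [phi i] that is nonnegative on [A] and has integral at
   most 0. So it vanishes almost everywhere, and one of the [phi i] is redundant
   on a smaller set of full measure. *)
Lemma moments_conic_hull n (phi : 'I_n -> T -> R) (A : set T) :
    (forall i, P.-integrable setT (EFin \o phi i)) ->
    measurable A -> P (~` A) = 0%E ->
  conic_hull [set \row_i phi i x | x in A]
    (\row_i fine (\int[P]_x (phi i x)%:E)).
Proof.
elim: n phi A => [|n IHn] phi A iphi mA A0.
  rewrite (_ : \row__ _ = 0); last by apply/rowP => -[].
  by have [] := conic_hull_convex_cone [set \row_i phi i x | x in A].
apply: contrapT => nhull; have [s [[j sj] sA sv]] := conic_hull_separation nhull.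
have [ih hE] := integral_lincomb s iphi.
set h := fun x => \sum_i phi i x * s i in ih.
have mh : measurable_fun setT h by exact/measurable_EFinP/measurable_int/ih.
have h0 x : A x -> 0 <= h x.
  move=> Ax; have := sA (\row_i phi i x); under eq_bigr do rewrite mxE.
  by apply; exists x.
have {}sv : \sum_i fine (\int[P]_x (phi i x)%:E) * s i <= 0.
  by apply: le_trans sv; under [leRHS]eq_bigr do rewrite mxE.
have hA : (\int[P]_x (h x)%:E = \int[P]_(x in A) (h x)%:E)%E.
  rewrite (negligible_integral (measurableC mA))//.
  by rewrite setDE setCK setTI.
have hA0 : (\int[P]_(x in A) (h x)%:E = 0)%E.
  apply/eqP; rewrite eq_le; apply/andP; split.
    by rewrite -hA hE lee_fin.
  by apply: integral_ge0 => x Ax; rewrite lee_fin h0.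
have vs0 : \sum_i fine (\int[P]_x (phi i x)%:E) * s i = 0.
  by apply: EFin_inj; rewrite -hE hA.
pose A' := A `&` h @^-1` [set 0].
have mA' : measurable A'.
  apply: measurableI => //; rewrite -[X in measurable X]setTI.
  exact: mh.
have A'0 : P (~` A') = 0%E.
  have [N [mN N0 hN]] : ae_eq P A (EFin \o h) (cst 0%E).
    apply/ae_eq_integral_abs => //.
      by apply/measurable_EFinP; exact: measurable_funS mh.
    rewrite -hA0; apply: eq_integral => x /[!inE] Ax /=.
    by rewrite ger0_norm// h0.
  apply/eqP; rewrite eq_le measure_ge0 andbT.
    apply: (@le_trans _ _ (P (~` A) + P N)%E); last by rewrite A0 N0 adde0.
    apply: (le_trans _ (measureU2 P (measurableC mA) mN)).
    apply: le_measure; rewrite ?inE; [exact: measurableC| |].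
      by apply: measurableU => //; exact: measurableC.
    move=> x A'x; have [Ax|] := pselect (A x); [right|by left].
    by apply: hN => /= /(_ Ax) [hx0]; apply: A'x.
have [N [w [g [w0 A'g vE]]]] := IHn (phi \o lift j) A' (fun i => iphi _) mA' A'0.
apply: nhull; exists N, w; have /choice[x xE] : forall k, exists x,
    A' x /\ \row_i phi (lift j i) x = g k.
  by move=> k; have [x A'x <-] := A'g k; exists x.
have gE k i : g k 0 i = phi (lift j i) (x k).
  by have [_ <-] := xE k; rewrite mxE.
have {}vE i : fine (\int[P]_x (phi (lift j i) x)%:E) =
    \sum_k w k * phi (lift j i) (x k).
  have /rowP/(_ i) := vE; rewrite !mxE => ->.
  by rewrite summxE; apply: eq_bigr => k _; rewrite mxE gE.
exists (fun k => \row_i phi i (x k)); split=> // [k|].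
  by have [[Ax _] _] := xE k; exists (x k).
apply/rowP => i; rewrite mxE summxE.
under eq_bigr do rewrite !mxE.
have [i'|->] := unliftP j i; first by move=> ->; exact: vE.
(* For the index [j]: [h] has integral 0 and vanishes at every node, so the moment of [phi j] and
   its node values are the same combination of those of the other functions, for which the rule is
   exact. *)
apply: (mulIf sj).
have /eqP := vs0; rewrite (bigD1_ord j)//= addr_eq0 => /eqP ->.
under eq_bigr do rewrite vE mulr_suml.
rewrite exchange_big/= mulr_suml -sumrN; apply: eq_bigr => k _.
have [[_ /eqP]] := xE k; rewrite /h (bigD1_ord j)//= addr_eq0 => /eqP hk _.
rewrite -mulrA hk mulrN mulr_sumr; congr (- _).
by apply: eq_bigr => i' _; rewrite mulrA.
Qed.
End moments.

(** * Dimension of a subspace inside a finite span *)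

Section finite_dimension.
Context {K : fieldType} {V : lmodType K}.

Lemma free_card_le_span n (I : finType) (b : 'I_n -> V) (b' : I -> V) :
    (forall c : 'I_n -> K, \sum_i c i *: b i = 0 -> forall i, c i = 0) ->
    (forall i, exists c : I -> K, b i = \sum_j c j *: b' j) ->
  (n <= #|I|)%N.
Proof.
move=> bfree /choice[C CE].
pose M := \matrix_(i < n, j < #|I|) C i (enum_val j).
suff /eqP <- : row_free M by exact: rank_leq_col.
rewrite -kermx_eq0; apply/eqP/row_matrixP => k; rewrite row0.
apply/rowP => i; rewrite [RHS]mxE.
set u := row k _; have uM : u *m M = 0 by apply/sub_kermxP; exact: row_sub.
apply: (bfree (u 0)); under eq_bigr do rewrite CE scaler_sumr.
rewrite exchange_big/= big1// => j _.
under eq_bigr do rewrite scalerA; rewrite -scaler_suml.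
have := congr1 (fun A : 'rV_#|I| => A 0 (enum_rank j)) uM; rewrite !mxE.
by under eq_bigr do rewrite [M _ _]mxE enum_rankK; move=> ->; rewrite scale0r.
Qed.

(** A free family in [E] of maximal size is a basis: adjoining [v] makes it dependent, with nonzero
    coefficient at [v]. The [b'] may lie outside [E], as some reduced monomials below have degree
    [r + 1]. *)
Lemma has_dim_sub_span (E : set V) (I : finType) (b' : I -> V) :
    E 0 -> (forall (a : K) u v, E u -> E v -> E (a *: u + v)) ->
    (forall v, E v -> exists c : I -> K, v = \sum_j c j *: b' j) ->
  exists2 n, (n <= #|I|)%N & has_dim E n.
Proof.
move=> E0 Elin Espan.
have Esum n (c : 'I_n -> K) (b : 'I_n -> V) :
    (forall i, E (b i)) -> E (\sum_i c i *: b i).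
  move=> Eb; apply: (big_ind E) => // [u v Eu Ev|i _].
    by rewrite -[u]scale1r; exact: Elin.
  by rewrite -[_ *: _]addr0; exact: Elin.
pose P k := `[< exists b : 'I_k -> V, (forall i, E (b i)) /\
  forall c : 'I_k -> K, \sum_i c i *: b i = 0 -> forall i, c i = 0 >].
have P0 : exists k, P k.
  by exists 0%N; apply/asboolP; exists (fun=> 0); split=> [[]|? ? []].
have PI k : P k -> (k <= #|I|)%N.
  by move=> /asboolP[b [Eb bfree]]; apply: (free_card_le_span bfree) => i; exact: Espan.
case: (ex_maxnP P0 PI) => k Pk kmax; exists k; first exact: PI.
move: Pk => /asboolP[b [Eb bfree]]; exists b; split=> //.
apply/seteqP; split=> [v Ev|_ [c ->]]; last exact: Esum.
pose bv (i : 'I_k.+1) := oapp b v (unlift ord0 i).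
have bv0 : bv ord0 = v by rewrite /bv unlift_none.
have bvS i : bv (lift ord0 i) = b i by rewrite /bv liftK.
have [c [cv [i ci]]] : exists c : 'I_k.+1 -> K,
    \sum_i c i *: bv i = 0 /\ exists i, c i != 0.
  apply: contrapT => /forallNP bvfree.
  suff /kmax : P k.+1 by rewrite ltnn.
  apply/asboolP; exists bv; split=> [i|c cv i].
    by have [j|] := unliftP ord0 i => ->; rewrite ?bv0 ?bvS.
  by apply/eqP; apply: contrapT => /negP ci; apply: (bvfree c); split=> //; exists i.
move: cv; rewrite big_ord_recl bv0; under eq_bigr do rewrite bvS.
have [c0|c0] := eqVneq (c ord0) 0.
  rewrite c0 scale0r add0r => /bfree cS; move: ci.
  by have [j|] := unliftP ord0 i => ->; rewrite ?c0 ?cS eqxx.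
move=> /eqP; rewrite addr_eq0 => /eqP cv.
exists (fun i => - (c ord0)^-1 * c (lift ord0 i)).
rewrite -[v](scalerK c0) cv scalerN -scaleNr scaler_sumr.
by apply: eq_bigr => j _; rewrite scalerA.
Qed.

End finite_dimension.

(** * Polynomials on the sphere: products, dimension and integrability *)

Section sphere_polynomials.
Context {R : realType} {d : nat}.
Implicit Types (k : 'I_d.+1 -> nat) (u : sphere R d) (f g : sphere R d -> R^o).

(* [monomial] with unbounded exponents. *)
Definition monomialn k u : R^o := \prod_i sphere_coord u i ^+ k i.

Lemma monomialn_add k l u :
  monomialn (fun i => k i + l i)%N u = monomialn k u * monomialn l u.
Proof. by rewrite -big_split/=; apply: eq_bigr => i _; rewrite exprD. Qed.

Lemma monomialn_delta (j : 'I_d.+1) (n : nat) u :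
  monomialn (fun i => (i == j) * n)%N u = sphere_coord u j ^+ n.
Proof.
rewrite /monomialn (bigD1 j)//= eqxx mul1n big1 ?mulr1// => i /negPf ->.
by rewrite mul0n.
Qed.

Lemma sphere_coord_sqr_sum u : \sum_i sphere_coord u i ^+ 2 = 1.
Proof.
have /eqP := svalP u; rewrite /enorm => h; rewrite -(expr1n _ 2) -h sqr_sqrtr//.
by apply: sumr_ge0 => i _; exact: sqr_ge0.
Qed.

Lemma norm_sphere_coord u i : `|sphere_coord u i| <= 1.
Proof.
rewrite -(@ler_pXn2r _ 2)// ?nnegrE// expr1n real_normK ?num_real//.
rewrite -(sphere_coord_sqr_sum u) (bigD1 i)//= lerDl.
by apply: sumr_ge0 => j _; exact: sqr_ge0.
Qed.

Lemma Pi_monomialn r k : (\sum_i k i <= r)%N -> Pi R d r (monomialn k).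
Proof.
move=> kr; have kir i : (k i < r.+1)%N.
  by rewrite ltnS (leq_trans _ kr)// (bigD1 i)//= leq_addr.
pose k' := [ffun i => Ordinal (kir i)] : {ffun 'I_d.+1 -> 'I_r.+1}.
exists (fun l => (l == k')%:R) => u.
rewrite (bigD1 k')/= ?eqxx ?mul1r.
  rewrite big1 ?addr0 => [|l /andP[_ /negPf ->]]; last by rewrite mul0r.
  by apply: eq_bigr => i _; rewrite ffunE.
by under eq_bigr do rewrite ffunE.
Qed.

Lemma Pi_linear r (a : R) f g : Pi R d r f -> Pi R d r g -> Pi R d r (a *: f + g).
Proof.
move=> [c fE] [c' gE]; exists (fun l => a * c l + c' l) => u.
rewrite !fctE fE gE [_ *: _]mulr_sumr -big_split/=; apply: eq_bigr => k _.
by rewrite mulrDl mulrA.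
Qed.

Lemma Pi0 r : Pi R d r 0.
Proof. by exists (fun=> 0) => u; rewrite big1// => k _; rewrite mul0r. Qed.

Lemma Pi_lincomb r (I : Type) (s : seq I) (P : pred I) (c : I -> R)
    (F : I -> sphere R d -> R^o) :
  (forall i, P i -> Pi R d r (F i)) -> Pi R d r (\sum_(i <- s | P i) c i *: F i).
Proof.
move=> PF; elim: s => [|i s IHs]; first by rewrite big_nil; exact: Pi0.
by rewrite big_cons; case: ifPn => // /PF Fi; exact: Pi_linear.
Qed.

Lemma PiE r f : Pi R d r f -> exists c : {ffun 'I_d.+1 -> 'I_r.+1} -> R,
  f = \sum_(l : {ffun 'I_d.+1 -> 'I_r.+1} | (\sum_i l i <= r)%N)
        c l *: monomialn (fun i => l i).
Proof.
move=> [c fE]; exists c; apply/funext => u.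
by rewrite fE fct_sumE.
Qed.

Lemma Pi_mul r r' f g : Pi R d r f -> Pi R d r' g -> Pi R d (r + r') (f * g).
Proof.
move=> /PiE[c ->] /PiE[c' ->].
rewrite mulr_suml.
under eq_bigr => k kr.
  have -> : c k *: monomialn (fun i => k i) *
      \sum_(l : {ffun 'I_d.+1 -> 'I_r'.+1} | (\sum_i l i <= r')%N)
        c' l *: monomialn (fun i => l i) =
    c k *: (\sum_(l : {ffun 'I_d.+1 -> 'I_r'.+1} | (\sum_i l i <= r')%N)
      c' l *: monomialn (fun i => k i + l i)%N).
    apply/funext => u; rewrite !fctE !fct_sumE -scalerAl; congr (_ *: _).
    rewrite mulr_sumr; apply: eq_bigr => l _.
    by rewrite !fctE monomialn_add scalerAr.
  over.
apply: Pi_lincomb => k kr; apply: Pi_lincomb => l lr; apply: Pi_monomialn.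
by rewrite big_split leq_add.
Qed.

Lemma Pi1 r : Pi R d r 1.
Proof.
have -> : 1 = monomialn (fun=> 0%N).
  by apply/funext => u; rewrite /monomialn big1// => i _; rewrite expr0.
by apply: Pi_monomialn; rewrite big1.
Qed.

Lemma Pi_exp r n f : Pi R d r f -> Pi R d (n * r) (f ^+ n).
Proof.
move=> fr; elim: n => [|n IHn]; first exact: Pi1.
by rewrite exprS mulSn; exact: Pi_mul.
Qed.

(** Exponents of [x_1, ..., x_d], written as tuples to match the counting lemma
    [card_partial_ord_partitions]. *)
Definition reduced_exponents r :=
  [set t : d.-tuple 'I_r.+1 | (\sum_(i <- t) i <= r)%N]%SET.

Definition reduced_monomial r (j : bool * 'I_#|reduced_exponents r|) :
    sphere R d -> R^o :=
  fun u => sphere_coord u ord0 ^+ j.1 *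
    \prod_(i < d) sphere_coord u (lift ord0 i) ^+ tnth (enum_val j.2) i.

(* On the sphere [x_0 ^ 2 = 1 - \sum_(i > 0) x_i ^ 2], which lowers the exponent
   of [x_0] without raising the degree. *)
Lemma monomialn_span r k : (\sum_i k i <= r)%N ->
  exists c : bool * 'I_#|reduced_exponents r| -> R,
    monomialn k = \sum_j c j *: reduced_monomial j.
Proof.
pose S f := exists c : bool * 'I_#|reduced_exponents r| -> R,
  f = \sum_j c j *: reduced_monomial j.
have SB f g : S f -> S g -> S (f - g).
  move=> [c ->] [c' ->]; exists (fun j => c j - c' j).
  by rewrite -sumrB; apply: eq_bigr => j _; rewrite scalerBl.
have SD f g : S f -> S g -> S (f + g).
  move=> [c ->] [c' ->]; exists (fun j => c j + c' j).
  by rewrite -big_split; apply: eq_bigr => j _; rewrite /= scalerDl.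
have S0 : S 0.
  by exists (fun=> 0); rewrite big1// => j _; rewrite scale0r.
rewrite -[exists _, _]/(S (monomialn k)).
have [n] := ubnP (k ord0); elim: n k => // n IHn k kn kr.
have [k2|k2] := ltnP (k ord0) 2.
  have kir (i : 'I_d) : (k (lift ord0 i) < r.+1)%N.
    by rewrite ltnS (leq_trans _ kr)// (bigD1 (lift ord0 i))//= leq_addr.
  pose t := [tuple Ordinal (kir i) | i < d].
  have tr : t \in reduced_exponents r.
    rewrite inE big_tuple; apply: leq_trans kr; rewrite big_ord_recl.
    rewrite (leq_trans _ (leq_addl _ _))//; apply: leq_sum => i _.
    by rewrite tnth_mktuple.
  (* Since [k ord0 < 2], this boolean, read as a number, is the exponent of [x_0]. *)
  pose j := (k ord0 == 1%N, enum_rank_in tr t).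
  exists (fun j' => (j' == j)%:R).
  rewrite (bigD1 j)//= eqxx scale1r big1 ?addr0 => [|i /negPf ->]; last first.
    by rewrite scale0r.
  apply/funext => u; rewrite /monomialn big_ord_recl /reduced_monomial/=.
  rewrite enum_rankK_in//; congr (_ ^+ _ * _).
    by case: (k ord0) k2 => [|[]].
  by apply: eq_bigr => i _; rewrite tnth_mktuple.
pose k0 i := (k i - (i == ord0) * 2)%N.
have k0E i : (k0 i + (i == ord0) * 2 = k i)%N.
  by rewrite /k0 subnK//; have [->|] := eqVneq i ord0; rewrite ?mul1n.
have delta_sum (j : 'I_d.+1) : (\sum_i (i == j) * 2 = 2)%N.
  by rewrite (bigD1 j)//= eqxx big1// => i /negPf ->.
have k0r : (\sum_i k0 i + 2 <= r)%N.
  by rewrite -(delta_sum ord0) -big_split/= (eq_bigr k).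
have k0n : (k0 ord0 < n)%N.
  rewrite /k0 eqxx mul1n; case: (k ord0) k2 kn => [|[|x]]//= _.
  by rewrite !ltnS subn2/=; exact: ltnW.
(* This is [x_0 ^ 2 = 1 - \sum_(i > 0) x_i ^ 2] multiplied by [monomialn k0]. Every term has
   [x_0]-exponent [k0 ord0] and degree at most that of [k], so the induction hypothesis applies. *)
have -> : monomialn k = monomialn k0 -
    \sum_(j < d) monomialn (fun i => k0 i + (i == lift ord0 j) * 2)%N.
  apply/funext => u; rewrite !fctE fct_sumE.
  under [in RHS]eq_bigr do rewrite monomialn_add monomialn_delta.
  rewrite -mulr_sumr -[X in X - _]mulr1 -mulrBr -(sphere_coord_sqr_sum u).
  rewrite big_ord_recl addrK -(monomialn_delta ord0) -monomialn_add.
  by congr (monomialn _ u); apply/funext => i; rewrite k0E.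
apply: SB; first by apply: IHn => //; exact: leq_trans (leq_addr _ _) k0r.
apply: (big_ind S) => // j _; apply: IHn; first by rewrite mul0n addn0.
by rewrite big_split/= delta_sum.
Qed.

(** The factor 2 counts the exponents 0 and 1 of [x_0], the binomial coefficient those of the other
    coordinates. *)
Lemma Pi_has_dim r : exists2 n, (n <= 2 * 'C(d + r, d))%N & has_dim (Pi R d r) n.
Proof.
rewrite -card_partial_ord_partitions.
have -> : (2 * #|reduced_exponents r| =
           #|{: bool * 'I_#|reduced_exponents r|}|)%N.
  by rewrite card_prod card_bool card_ord.
apply: (has_dim_sub_span (b' := @reduced_monomial r)).
- exact: Pi0.
- by move=> a f g; exact: Pi_linear.
move=> _ /PiE[c ->].
have /choice[C CE] : forall l : {ffun 'I_d.+1 -> 'I_r.+1},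
    exists b : bool * 'I_#|reduced_exponents r| -> R,
    (\sum_i l i <= r)%N -> monomialn (fun i => l i) = \sum_j b j *: reduced_monomial j.
  move=> l; have [lr|] := leqP (\sum_i l i) r; last by exists (fun=> 0).
  by have [b bE] := monomialn_span lr; exists b.
exists (fun j => \sum_(l : {ffun 'I_d.+1 -> 'I_r.+1} | (\sum_i l i <= r)%N) c l * C l j).
under eq_bigr => l lr do rewrite CE// scaler_sumr.
rewrite exchange_big/=; apply: eq_bigr => j _.
by rewrite scaler_suml; apply: eq_bigr => l _; rewrite scalerA.
Qed.

Lemma measurable_sphere_coord i :
  measurable_fun setT (fun u : sphere R d => sphere_coord u i).
Proof.
rewrite (_ : (fun _ => _) = (fun x : d.+1.-tuple R => tnth x i) \o sval)//.
apply: measurableT_comp; first exact: measurable_tnth.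
move=> _ B mB; rewrite setTI; exists B => //.
by rewrite setTI.
Qed.

(** Coordinates are bounded by 1 in absolute value and the measure is finite. *)
Lemma integrable_monomialn k :
  (sphere_measure (R := R) (d := d)).-integrable setT (EFin \o monomialn k).
Proof.
apply: measurable_bounded_integrable => //.
- exact: le_lt_trans (probability_le1 sphere_measure measurableT) (ltry _).
- apply: measurable_prod => i _.
  by apply: measurable_funX; exact: measurable_sphere_coord.
- exists 1; split=> // M M1 u _; apply: (le_trans _ (ltW M1)).
  rewrite normr_prod; apply: prodr_ile1 => i _.
  rewrite normr_ge0 normrX exprn_ile1//; exact: norm_sphere_coord.
Qed.

Lemma integrable_Pi r f : Pi R d r f ->
  (sphere_measure (R := R) (d := d)).-integrable setT (EFin \o f).
Proof.
move=> /PiE[c fE].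
have ic (l : {ffun 'I_d.+1 -> 'I_r.+1}) :
    (sphere_measure (R := R) (d := d)).-integrable setT
      (fun u => ((c l)%:E * (monomialn (fun i => l i) u)%:E)%E).
  exact: (integrableZl measurableT (c l) (integrable_monomialn _)).
have := integrable_sum measurableT (index_enum _)
  (fun (l : {ffun 'I_d.+1 -> 'I_r.+1}) (_ : (\sum_i l i <= r)%N) => ic l).
apply: eq_integrable => // u _ /=.
rewrite fE fct_sumE -sumEFin; apply: eq_bigr => l _.
by rewrite EFinM.
Qed.

End sphere_polynomials.

(** * Estimates for factorials and binomial coefficients *)

Lemma ffact_ge_expn n d : (n ^ d <= (n + d) ^_ d)%N.
Proof.
elim: d => // d IHd; rewrite addnS ffactSS expnS leq_mul//.
by rewrite (leq_trans _ (leqnSn _))// leq_addr.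
Qed.

Lemma ffact_le_expn n d : (n ^_ d <= n ^ d)%N.
Proof.
elim: d n => [|d IHd] n; first by rewrite ffactn0.
by rewrite ffactnSr expnSr leq_mul// leq_subr.
Qed.

(* [d ^ d <= 'C(2 * d, d) * d`! <= 4 ^ d * d`!] replaces Stirling's bound. *)
Lemma expnn_le_fact d : (d ^ d <= 4 ^ d * d`!)%N.
Proof.
apply: leq_trans (ffact_ge_expn d d) _; rewrite -bin_ffact leq_mul2r.
apply/orP; right; rewrite addnn -mul2n (_ : 4 = 2 ^ 2)%N// -expnM.
(* The coefficient ['C(2 * d, d)] is one term of the expansion of [(1 + 1) ^ (2 * d)]. *)
have := expnDn 1 1 (2 * d).
rewrite addn1 => ->; have h : (d < (2 * d).+1)%N by rewrite ltnS mul2n -addnn leq_addr.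
by rewrite (bigD1 (Ordinal h))//= !exp1n !muln1 leq_addr.
Qed.

Lemma binomial_bound d r : (1 <= d)%N -> (2 * d <= r)%N ->
  (2 * 'C(d + r, d) * d ^ d <= (9 * r) ^ d)%N.
Proof.
case: d => [//|[_ r2|d _ dr]].
  rewrite bin1 !expn1; move: r2; lia.
set e := d.+2.
have Ce : ('C(e + r, e) * e`! <= (e + r) ^ e)%N.
  by rewrite bin_ffact; exact: ffact_le_expn.
(* This absorbs the factor 2 and needs [e >= 2], which is why [d = 1] is treated apart. *)
have e2 : (2 * (12 ^ e) <= 18 ^ e)%N.
  rewrite /e; elim: d {e dr Ce} => // d IHd.
  by rewrite expnS mulnCA (expnS 18) leq_mul.
(* The factor [2 ^ e] avoids fractions: [2 * e <= r] gives [2 * (e + r) <= 3 * r]. The constants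
   combine to [2 * 4 ^ e * 3 ^ e = 2 * 12 ^ e <= 18 ^ e = 2 ^ e * 9 ^ e]. *)
rewrite -(@leq_pmul2l (2 ^ e)) ?expn_gt0//.
apply: (@leq_trans (2 * 4 ^ e * (2 ^ e * ('C(e + r, e) * e`!)))).
  rewrite [leqLHS](_ : _ = 2 ^ e * (2 * 'C(e + r, e)) * e ^ e)%N; last by lia.
  rewrite [leqRHS](_ : _ = 2 ^ e * (2 * 'C(e + r, e)) * (4 ^ e * e`!))%N.
    by rewrite leq_mul2l expnn_le_fact orbT.
  by lia.
apply: (@leq_trans (2 * 4 ^ e * (3 * r) ^ e)).
  rewrite leq_mul2l; apply/orP; right.
  apply: (@leq_trans ((2 * (e + r)) ^ e)); first by rewrite expnMn leq_mul2l Ce orbT.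
  by rewrite leq_exp2r//; move: dr; rewrite -/e; lia.
rewrite expnMn mulnA -[(2 * _ * _)%N]mulnA -expnMn.
rewrite [(2 ^ e * _)%N](_ : _ = 18 ^ e * r ^ e)%N.
  by rewrite leq_mul.
by rewrite -!expnMn mulnA.
Qed.

(** * Positive quadrature on the sphere *)

Lemma quadrature_Pi (R : realType) (d r : nat) :
  exists (N : nat) (x : 'I_N -> sphere R d) (w : 'I_N -> R),
    [/\ forall i, 0 < w i, (N <= dimension (Pi R d r))%N
      & forall f, Pi R d r f -> (\int[sphere_measure]_u (f u)%:E =
          (\sum_(i < N) w i * f (x i))%:E)%E].
Proof.
have [n _ dimn] := @Pi_has_dim R d r.
rewrite (has_dimE dimn); have [b [bfree bspan]] := dimn.
have bPi i : Pi R d r (b i).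
  rewrite bspan; exists (fun j => (j == i)%:R).
  by rewrite (bigD1 i)//= eqxx scale1r big1 ?addr0// => j /negPf ->; rewrite scale0r.
have ib i := integrable_Pi (bPi i).
(* The set of full measure is the whole sphere; exactness on the basis [b] then extends to [Pi] by
   linearity. *)
have := moments_conic_hull ib measurableT.
rewrite setCT measure0 => /(_ erefl)/conic_caratheodory[N [w [g [Nn w0 gb vE]]]].
have /choice[x xE] : forall k, exists x, \row_i b i x = g k.
  by move=> k; have [x _ <-] := gb k; exists x.
exists N, x, w; split=> // f; rewrite bspan => -[c ->].
have [_] := integral_lincomb c ib.
have E u : (\sum_i c i *: b i) u = \sum_i b i u * c i.
  by rewrite fct_sumE; apply: eq_bigr => i _; rewrite mulrC.
under eq_integral do rewrite -E.
move=> ->; congr EFin.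
have {}vE i : fine (\int[sphere_measure]_u (b i u)%:E) = \sum_k w k * b i (x k).
  have /rowP/(_ i) := vE; rewrite mxE => ->; rewrite summxE.
  by apply: eq_bigr => k _; rewrite mxE -xE mxE.
under eq_bigr do rewrite vE mulr_suml.
rewrite exchange_big/=; apply: eq_bigr => k _.
by rewrite E mulr_sumr; apply: eq_bigr => i _; rewrite mulrA.
Qed.

Theorem theorem5p5 (R : realType) (d m p : nat)
    (hd : (1 <= d)%N) (hm : (d <= m)%N) (hp : (1 <= p)%N) (hp2 : ~~ odd p) :
  exists (N : nat) (x : 'I_N -> sphere R d) (w : 'I_N -> R),
    [/\ forall i, 0 < w i,
        \sum_(i < N) w i = 1,
        (N <= dimension (Pi R d (p * m)%N))%N,
        (dimension (Pi R d (p * m)%N))%:R <= (9 * p%:R * m%:R / d%:R : R) ^+ d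
      & forall f : sphere R d -> R, Pi R d m f ->
          (\int[sphere_measure]_u (`|f u| ^+ p)%:E)%E
          = (\sum_(i < N) w i * `|f (x i)| ^+ p)%:E].
Proof.
have [N [x [w [w0 Ndim quad]]]] := quadrature_Pi R d (p * m).
exists N, x, w; split=> // [||f fm].
- apply: EFin_inj; have := quad _ (Pi1 (p * m)).
  under eq_bigr do rewrite mulr1.
  move=> <-; apply: etrans (integral_cst sphere_measure measurableT 1%E) _.
  by rewrite mul1e; exact: probability_setT.
- have [n ndim /has_dimE ->] := @Pi_has_dim R d (p * m).
  rewrite expr_div_n ler_pdivlMr ?exprn_gt0 ?ltr0n// -!natrM -!natrX -natrM ler_nat.
  rewrite -mulnA; apply: (leq_trans _ (binomial_bound hd _)).
    by rewrite leq_mul2r ndim orbT.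
  (* A positive even [p] is at least 2, so [d <= m] yields the condition [2 * d <= p * m] of
     [binomial_bound]. *)
  rewrite leq_mul//; case: p hp hp2 {quad w0 Ndim ndim} => [|[|]]//.
- have /quad := Pi_exp p fm.
  have E u : `|f u| ^+ p = (f ^+ p) u.
    rewrite -normrX ger0_norm; last by rewrite exprn_even_ge0// hp2.
    by elim: (p) => // n IHn; rewrite !exprS IHn.
  under eq_integral do rewrite -E.
  by move=> ->; under eq_bigr do rewrite -E.
Qed.
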